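(* Let $q>1$ be a real number, let $s\in\mathbb{R}$, and let $m=(m_p)_{p\ge0}$ be a sequence of positive real numbers with $m_0=1$. Then $m$ is of $q$-Gevrey order $s$ if and only if it is of (generalized) $q$-Gevrey order $s$.
   Context: Definition: $m$ is of $q$-Gevrey order $s\in\mathbb{R}$ if there exist $a,A>0$ and $\alpha,\beta\in\mathbb{R}$ such that $a^pp!^{\alpha}q^{s\frac{p(p-1)}{2}}\le m_{p}\le A^pp!^{\beta}q^{s\frac{p(p-1)}{2}}$ for every $p\ge0$. Definition: $m$ is of (generalized) $q$-Gevrey order $s\in\mathbb{R}$ if there exist $a,A>0$ and a sequence of positive real numbers $\mathbb{M}=(M_p)_{p\ge0}$ with $M_0=1$ satisfying (mg) and (lc), such that $a^p\frac{1}{M_p}q^{s\frac{p(p-1)}{2}}\le m_{p}\le A^pM_pq^{s\frac{p(p-1)}{2}}$ for every $p\ge0$. Here: (mg) (moderate growth): there exists $A'>0$ such that $M_{n+k}\le A'^{\,n+k}M_nM_k$ for all integers $n,k\ge0$; (lc) (logarithmic convexity): $M_n^2\le M_{n-1}M_{n+1}$ for every $n\ge1$. *)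

(* Defs.v *)
(* Stdlib world: concrete classical reals, real powers via Rpower. *)
From Stdlib Require Import Factorial Reals.
Open Scope R_scope.

(* q^(s p(p-1)/2); the exponent is computed in R, so it is 0 at p = 0. *)
Definition q_weight (q s : R) (p : nat) : R :=
  Rpower q (s * (INR p * (INR p - 1) / 2)).

Definition q_Gevrey_order (q s : R) (m : nat -> R) : Prop :=
  exists a A alpha beta : R,
    0 < a /\ 0 < A /\
    forall p : nat,
      a ^ p * Rpower (INR (fact p)) alpha * q_weight q s p <= m p /\
      m p <= A ^ p * Rpower (INR (fact p)) beta * q_weight q s p.

Definition moderate_growth (M : nat -> R) : Prop :=
  exists A : R, 0 < A /\
    forall n k : nat, M (n + k)%nat <= A ^ (n + k) * M n * M k.

Definition log_convex (M : nat -> R) : Prop :=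
  forall n : nat, (1 <= n)%nat -> M n ^ 2 <= M (n - 1)%nat * M (n + 1)%nat.

Definition generalized_q_Gevrey_order (q s : R) (m : nat -> R) : Prop :=
  exists (a A : R) (M : nat -> R),
    0 < a /\ 0 < A /\
    (forall p : nat, 0 < M p) /\ M 0%nat = 1 /\
    moderate_growth M /\ log_convex M /\
    forall p : nat,
      a ^ p * (1 / M p) * q_weight q s p <= m p /\
      m p <= A ^ p * M p * q_weight q s p.

(* Main.v *)
(** If [m] is of [q]-Gevrey order [s], take [M_p = p!^g] with [g] at least [|alpha|] and [|beta|].
    Conversely, (mg) alone forces [M_p <= C^p p!^b]: splitting [n = j + k] into halves,
    [M_n <= A^n M_j M_k], and the factor [A^n] is absorbed by [binom(n, k)^b >= 2^(k b)]
    as soon as [2^b >= A^3]. *)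
Require Import Defs.
From Stdlib Require Import Reals Lra Lia Arith Factorial.
Open Scope R_scope.

(** The binomial coefficient binom(n + k, n) is at most 2^(n + k), by Pascal's rule in a form
    without division. *)
Lemma fact_add_le (n k : nat) :
  (fact (n + k) <= 2 ^ (n + k) * (fact n * fact k))%nat.
Proof.
  revert k; induction n as [|n IHn]; intro k.
  - assert (1 <= 2 ^ k)%nat by (apply Nat.neq_0_lt_0, Nat.pow_nonzero; lia).
    simpl; nia.
  - induction k as [|k IHk].
    + assert (1 <= 2 ^ (S n + 0))%nat by (apply Nat.neq_0_lt_0, Nat.pow_nonzero; lia).
      rewrite Nat.add_0_r in *; change (fact 0) with 1%nat; nia.
    + specialize (IHn (S k)).
      replace (n + S k)%nat with (S n + k)%nat in IHn by lia.
      replace (S n + S k)%nat with (S (S n + k)) by lia.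
      rewrite Nat.pow_succ_r'.
      rewrite (fact_simpl (S n + k)).
      rewrite (fact_simpl k), (fact_simpl n) in *.
      set (P := (2 ^ (S n + k))%nat) in *.
      set (F := fact (S n + k)) in *.
      replace (S (S n + k) * F)%nat with (S n * F + S k * F)%nat by ring.
      apply Nat.le_trans with
        (S n * (P * (fact n * (S k * fact k))) + S k * (P * (S n * fact n * fact k)))%nat.
      * apply Nat.add_le_mono; apply Nat.mul_le_mono_l; assumption.
      * apply Nat.eq_le_incl; ring.
Qed.

(** Here binom(j + k, k) is the product of (j + i) / i over 1 <= i <= k, and each factor is at least
    2 because i <= j. *)
Lemma pow2_fact_le (j k : nat) : (k <= j)%nat ->
  (2 ^ k * (fact j * fact k) <= fact (j + k))%nat.
Proof.
  induction k as [|k IH]; intro hk.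
  - rewrite Nat.add_0_r; simpl; lia.
  - specialize (IH ltac:(lia)).
    rewrite Nat.add_succ_r, (fact_simpl (j + k)), (fact_simpl k), Nat.pow_succ_r'.
    apply Nat.le_trans with ((2 * S k) * (2 ^ k * (fact j * fact k)))%nat.
    + apply Nat.eq_le_incl; ring.
    + apply Nat.mul_le_mono; [lia | exact IH].
Qed.

Lemma INR_fact_ge_1 (n : nat) : 1 <= INR (fact n).
Proof.
  change 1 with (INR 1); apply le_INR; pose proof (lt_O_fact n); lia.
Qed.

Lemma Rpower_pos (x y : R) : 0 < Rpower x y.
Proof. apply exp_pos. Qed.

Lemma Rpower_1_base (y : R) : Rpower 1 y = 1.
Proof. unfold Rpower; rewrite ln_1, Rmult_0_r; apply exp_0. Qed.

Lemma Rpower_pow_base (x b : R) (k : nat) : 0 < x ->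
  Rpower (x ^ k) b = Rpower x b ^ k.
Proof.
  intro hx.
  rewrite <- (Rpower_pow k x hx), <- (Rpower_pow k _ (Rpower_pos x b)), !Rpower_mult.
  f_equal; ring.
Qed.

Lemma Rpower_fact_log_convex (g : R) : 0 <= g ->
  log_convex (fun p => Rpower (INR (fact p)) g).
Proof.
  intros hg [|n] hn; [lia|].
  replace (S n - 1)%nat with n by lia; replace (S n + 1)%nat with (S (S n)) by lia.
  rewrite <- Rpower_pow_base by apply INR_fact_lt_0.
  rewrite Rpower_mult_distr by apply INR_fact_lt_0.
  apply Rle_Rpower_l; [exact hg|].
  split; [apply pow_lt, INR_fact_lt_0|].
  rewrite <- pow_INR, <- mult_INR; apply le_INR.
  rewrite !fact_simpl; simpl Nat.pow; nia.
Qed.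

Lemma Rpower_fact_moderate_growth (g : R) : 0 <= g ->
  moderate_growth (fun p => Rpower (INR (fact p)) g).
Proof.
  (* This constant comes from raising the bound binom(n + k, n) <= 2^(n + k) to the power [g]. *)
  intro hg; exists (Rpower 2 g); split; [apply Rpower_pos|].
  intros n k.
  assert (h2 : 0 < 2 ^ (n + k)) by (apply pow_lt; lra).
  pose proof (INR_fact_lt_0 n); pose proof (INR_fact_lt_0 k).
  rewrite <- Rpower_pow_base by lra.
  rewrite !Rpower_mult_distr by (try apply Rmult_lt_0_compat; assumption).
  apply Rle_Rpower_l; [exact hg|].
  split; [apply INR_fact_lt_0|].
  replace 2 with (INR 2) by reflexivity.
  rewrite <- pow_INR, <- !mult_INR; apply le_INR.
  rewrite <- Nat.mul_assoc; apply fact_add_le.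
Qed.

Lemma moderate_growth_fact_bound (M : nat -> R) :
  (forall p, 0 < M p) -> M 0%nat = 1 -> moderate_growth M ->
  exists C b : R, 0 < C /\ forall p, M p <= C ^ p * Rpower (INR (fact p)) b.
Proof.
  intros hM hM0 [A0 [hA0 hmg]].
  (* Enlarging the constant to at least 1 makes [b] nonnegative and powers of [A] monotone in the
     exponent. *)
  set (A := Rmax A0 1).
  assert (hA : 1 <= A) by apply Rmax_r.
  set (b := ln (A ^ 3) / ln 2).
  assert (hln2 : 0 < ln 2) by (rewrite <- ln_1; apply ln_increasing; lra).
  assert (hA3 : 1 <= A ^ 3) by (apply pow_R1_Rle; exact hA).
  assert (hb2 : Rpower 2 b = A ^ 3).
  { unfold Rpower, b.
    replace (ln (A ^ 3) / ln 2 * ln 2) with (ln (A ^ 3)) by (field; lra).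
    apply exp_ln; lra. }
  assert (hb : 0 <= b).
  { apply Rmult_le_pos; [|left; apply Rinv_0_lt_compat, hln2].
    rewrite <- ln_1; destruct hA3 as [hlt | <-]; [left; apply ln_increasing; lra | apply Rle_refl]. }
  assert (hC : 0 < M 1%nat) by apply hM.
  (* The factor C^p splits exactly as C^j C^k, so the induction puts no constraint on C; C = M_1 is
     what the case p = 1 requires. *)
  exists (M 1%nat), b; split; [exact hC|].
  intro p; induction p as [p IH] using (well_founded_induction lt_wf).
  destruct (Nat.le_gt_cases 2 p) as [hp|hp].
  2: { destruct p as [|[|p]]; [| |lia]; simpl fact; simpl INR;
       rewrite Rpower_1_base; simpl; lra. }
  (* Since p >= 2, both halves are nonzero, hence smaller than p. *)
  set (k := Nat.div2 p); set (j := (p - k)%nat).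
  assert (hk : (1 <= k /\ k <= j /\ j <= k + 1 /\ p = j + k)%nat).
  { pose proof (Nat.div2_odd p) as e; unfold j, k; destruct (Nat.odd p); cbn [Nat.b2n] in e; lia. }
  clearbody j k; destruct hk as (hk1 & hkj & hjk & ->).
  pose proof (IH j ltac:(lia)) as IHj; pose proof (IH k ltac:(lia)) as IHk.
  set (Fj := INR (fact j)) in *; set (Fk := INR (fact k)) in *.
  assert (hFj : 0 < Fj) by apply INR_fact_lt_0.
  assert (hFk : 0 < Fk) by apply INR_fact_lt_0.
  (* The exponent 3 in [b] is used here: j <= k + 1 and 1 <= k give j + k <= 3k, and A^(3k) =
     (2^k)^b. *)
  assert (hpow : A0 ^ (j + k) <= Rpower (2 ^ k) b).
  { rewrite Rpower_pow_base, hb2, <- pow_mult by lra.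
    apply Rle_trans with (A ^ (j + k)).
    - apply pow_incr; split; [lra | apply Rmax_l].
    - apply Rle_pow; [exact hA | lia]. }
  assert (hfact : Rpower (2 ^ k) b * (Rpower Fj b * Rpower Fk b)
                  <= Rpower (INR (fact (j + k))) b).
  { assert (0 < 2 ^ k) by (apply pow_lt; lra).
    rewrite !Rpower_mult_distr by (try apply Rmult_lt_0_compat; assumption).
    apply Rle_Rpower_l; [exact hb|]; split.
    - repeat apply Rmult_lt_0_compat; assumption.
    - unfold Fj, Fk; replace 2 with (INR 2) by reflexivity.
      rewrite <- pow_INR, <- !mult_INR; apply le_INR, pow2_fact_le, hkj. }
  pose proof (hM j); pose proof (hM k).
  apply Rle_trans with (1 := hmg j k).
  apply Rle_trans with
    (Rpower (2 ^ k) b * ((M 1%nat ^ j * Rpower Fj b) * (M 1%nat ^ k * Rpower Fk b))).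
  - rewrite Rmult_assoc.
    apply Rmult_le_compat; [apply pow_le; lra | apply Rmult_le_pos; lra | exact hpow |].
    apply Rmult_le_compat; lra.
  - rewrite pow_add.
    replace (Rpower (2 ^ k) b * ((M 1%nat ^ j * Rpower Fj b) * (M 1%nat ^ k * Rpower Fk b)))
      with ((M 1%nat ^ j * M 1%nat ^ k) * (Rpower (2 ^ k) b * (Rpower Fj b * Rpower Fk b)))
      by ring.
    apply Rmult_le_compat_l; [|exact hfact].
    apply Rmult_le_pos; apply pow_le; lra.
Qed.

Theorem proposition4 (q s : R) (m : nat -> R)
  (hq : 1 < q) (hm : forall p : nat, 0 < m p) (hm0 : m 0%nat = 1) :
  q_Gevrey_order q s m <-> generalized_q_Gevrey_order q s m.
Proof.
  assert (hw : forall p, 0 <= q_weight q s p) by (intro p; left; apply Rpower_pos).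
  split.
  - intros (a & A & alpha & beta & ha & hA & h).
    (* As p! >= 1, the inequalities -g <= alpha and beta <= g yield the lower and upper bounds,
       while g >= 0 gives (mg) and (lc). *)
    set (g := Rmax (Rabs alpha) (Rabs beta)).
    assert (h1 : Rabs alpha <= g) by apply Rmax_l.
    assert (h2 : Rabs beta <= g) by apply Rmax_r.
    pose proof (Rabs_pos alpha); pose proof (Rle_abs beta).
    pose proof (Rle_abs (- alpha)) as h3; rewrite Rabs_Ropp in h3.
    exists a, A, (fun p => Rpower (INR (fact p)) g).
    split; [exact ha|]. split; [exact hA|].
    split; [intro p; apply Rpower_pos|].
    split; [simpl; apply Rpower_1_base|].
    split; [apply Rpower_fact_moderate_growth; lra|].
    split; [apply Rpower_fact_log_convex; lra|].
    intro p; destruct (h p) as [hl hu]; pose proof (INR_fact_ge_1 p); split.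
    + refine (Rle_trans _ _ _ _ hl).
      apply Rmult_le_compat_r; [apply hw|].
      apply Rmult_le_compat_l; [apply pow_le; lra|].
      unfold Rdiv; rewrite Rmult_1_l, <- Rpower_Ropp.
      apply Rle_Rpower; lra.
    + apply Rle_trans with (1 := hu).
      apply Rmult_le_compat_r; [apply hw|].
      apply Rmult_le_compat_l; [apply pow_le; lra|].
      apply Rle_Rpower; lra.
  - intros (a & A & M & ha & hA & hM & hM0 & hmg & _ & h).
    destruct (moderate_growth_fact_bound M hM hM0 hmg) as (C & b & hC & hb).
    (* Inverting M_p <= C^p p!^b gives the lower bound, which explains [a / C] and [- b]. *)
    exists (a / C), (A * C), (- b), b.
    split; [apply Rdiv_lt_0_compat; assumption|].
    split; [apply Rmult_lt_0_compat; assumption|].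
    intro p; destruct (h p) as [hl hu]; split.
    + refine (Rle_trans _ _ _ _ hl).
      apply Rmult_le_compat_r; [apply hw|].
      unfold Rdiv; rewrite Rpow_mult_distr, pow_inv, Rpower_Ropp, Rmult_assoc.
      apply Rmult_le_compat_l; [apply pow_le; lra|].
      rewrite Rmult_1_l, <- Rinv_mult.
      apply Rinv_le_contravar; [apply hM | apply hb].
    + apply Rle_trans with (1 := hu).
      apply Rmult_le_compat_r; [apply hw|].
      rewrite Rpow_mult_distr, Rmult_assoc.
      apply Rmult_le_compat_l; [apply pow_le; lra | apply hb].
Qed.
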